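(* Let $\lambda>0$ and $q>0$. Let the knowledge points form a homogeneous Poisson point process of intensity $\lambda$ on $\mathbb{R}$, let $x$ be a uniformly drawn task independent of the knowledge points, let $\sigma^2(x)$ be the local posterior variance at $x$, and let $U(x)=1-\sigma^2(x)/q$. Then a blind user adopts, i.e. $\mathbb{E}[U(x)]\ge 0$, if and only if $$q\ge \frac{1}{3\lambda}.$$ Equivalently, with the reliability ratio $R\equiv 3\lambda q$, adoption occurs if and only if $R\ge 1$.
   Context: Setting (Brownian--Poisson baseline). The truth $Y$ is a driftless Brownian motion in the task coordinate, and the model observes $Y$ exactly at the knowledge points. For a task $x$ lying between consecutive knowledge points $x_i<x<x_{i+1}$, the posterior variance of $Y(x)$ given the observed data is the Brownian-bridge variance $$\sigma^2(x)=\frac{(x-x_i)(x_{i+1}-x)}{x_{i+1}-x_i}.$$ A uniformly drawn task is a random variable uniformly distributed on some bounded interval of positive length, independent of the point process. The user's payoff from using the AI at task $x$ is $U(x)=1-\sigma^2(x)/q$, where $q>0$ is a stakes parameter; the outside option yields $0$. A blind user does not observe $\sigma^2(x)$ and adopts the AI if and only if $\mathbb{E}[U(x)]\ge 0$. *)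

(* Defs.v *)
From HB Require Import structures.
From mathcomp Require Import all_boot all_order all_algebra.
From mathcomp Require Import all_classical all_reals all_analysis.
From mathcomp Require Import measurable_realfun.

Set Implicit Arguments.
Unset Strict Implicit.
Unset Printing Implicit Defensive.

Import Order.TTheory GRing.Theory Num.Theory.
Import numFieldNormedType.Exports.

Local Open Scope classical_set_scope.
Local Open Scope ring_scope.

Section PoissonPointProcess.
Context {R : realType} {d : measure_display} {T : measurableType d}.
Implicit Types (P : probability T R) (Xi : T -> set R).

Definition locally_finite (S : set R) : Prop :=
  forall a b : R, finite_set (S `&` `[a, b]).

Definition npoints Xi (A : set R) (w : T) : \bar R := counting (Xi w `&` A).

(* A simple point process is encoded by its random set of points. *)
Definition point_process Xi : Prop :=
  (forall w, locally_finite (Xi w)) /\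
  (forall A : set R, measurable A -> measurable_fun setT (npoints Xi A)).

(* Taking C i = setT shows that subfamilies satisfy the product rule too. *)
Definition mutually_independent P (n : nat) (N : 'I_n -> T -> \bar R) : Prop :=
  forall C : 'I_n -> set (\bar R), (forall i, measurable (C i)) ->
    P (\bigcap_i (N i @^-1` C i)) = (\prod_(i < n) P (N i @^-1` C i))%E.

(* The library's [poisson_prob r] is the Poisson law of mean [r] on [set nat]
   (the Dirac mass at 0 when [r = 0]); it takes an extra natural number that it
   does not use. *)
Definition homogeneous_poisson P (lambda : R) Xi : Prop :=
  [/\ point_process Xi,
      (forall A : set R, measurable A -> (lebesgue_measure A < +oo)%E ->
         forall k : nat,
           P [set w | npoints Xi A w = k%:R%:E] =
           poisson_prob (lambda * fine (lebesgue_measure A)) k [set k])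
    & (forall (n : nat) (A : 'I_n -> set R),
         (forall i, measurable (A i)) -> trivIset setT A ->
         mutually_independent P (fun i => npoints Xi (A i)))].

Definition sigma_point_process Xi : set (set T) :=
  <<s \bigcup_(A in (measurable : set (set R)))
        preimage_set_system setT (npoints Xi A) measurable >>.

Definition independent_of_process P Xi (x : {RV P >-> R}) : Prop :=
  forall (E : set T) (B : set R), sigma_point_process Xi E -> measurable B ->
    P (E `&` x @^-1` B) = (P E * P (x @^-1` B))%E.

Definition uniform_on P (a b : R) (ab : a < b) (x : {RV P >-> R}) : Prop :=
  forall B : set R, measurable B -> distribution P x B = uniform_prob ab B.

End PoissonPointProcess.

Section Payoff.
Context {R : realType}.
Implicit Types (S : set R) (x : R).

(* Nearest knowledge points around x. The weak inequality on the left makes the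
   variance below vanish when x is itself a knowledge point, where the truth is
   observed. With no knowledge point on one side of x, a null event for the
   Poisson process, sup or inf takes its default value. *)
Definition left_knowledge_point S x : R := sup [set y | S y /\ y <= x].
Definition right_knowledge_point S x : R := inf [set y | S y /\ x < y].

(* Conditional variance at x of a standard Brownian motion observed on S: the
   variance of the Brownian bridge between the two neighbours of x. *)
Definition posterior_variance S x : R :=
  let l := left_knowledge_point S x in
  let r := right_knowledge_point S x in
  (x - l) * (r - x) / (r - l).

Definition payoff (q : R) S x : R := 1 - posterior_variance S x / q.

Definition reliability_ratio (lambda q : R) : R := 3 * lambda * q.

End Payoff.

Definition blind_adopts {R : realType} {d : measure_display}
    {T : measurableType d} (P : probability T R) (U : T -> R) : Prop :=
  (0 <= 'E_P[U])%E.

(* Main.v *)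
Require Import Defs.
From HB Require Import structures.
From mathcomp Require Import all_boot all_order all_algebra.
From mathcomp Require Import all_classical all_reals all_analysis.
From mathcomp Require Import measurable_realfun.
From mathcomp Require Import ring lra.
Set Implicit Arguments.
Unset Strict Implicit.
Unset Printing Implicit Defensive.
Import Order.TTheory GRing.Theory Num.Theory.
Import numFieldNormedType.Exports.
Local Open Scope classical_set_scope.
Local Open Scope ring_scope.

(* The gaps X and Y from the task to its two neighbouring knowledge points are
   independent exponential variables of rate lambda. Indeed, when the task lies
   in a cell of a grid of mesh e, the event {X >= s, Y >= u} is squeezed between
   the events that two deterministic intervals of lengths s + u + e and
   s + u - e contain no point; by independence of the task these have
   probability exp(- lambda (s + u +/- e)) whatever the cell, and e tends to 0.

   The expected posterior variance then follows from
     X Y / (X + Y) = \int_0^oo (X exp(- z X)) (Y exp(- z Y)) dz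
   together with E[X exp(- z X)] = lambda / (lambda + z)^2, since
     \int_0^oo lambda^2 / (lambda + z)^4 dz = 1 / (3 lambda). *)

(** * Explicit improper integrals on half-lines, by the fundamental theorem of calculus *)

Lemma ge0_integral_is_derive {R : realType} (f F : R -> R) (a l : R) :
  (forall x : R, a <= x -> 0 <= f x) ->
  (forall x : R, a <= x -> {for x, continuous f}) ->
  (forall x : R, a <= x -> is_derive x 1 F (f x)) ->
  F x @[x --> +oo] --> l ->
  (\int[lebesgue_measure]_(x in `[a, +oo[) (f x)%:E = (l - F a)%:E)%E.
Proof.
move=> f0 cf dF Fl; rewrite EFinB; apply: ge0_continuous_FTC2y => //.
- apply: continuous_in_subspaceT => x.
  by rewrite inE/= in_itv/= andbT; exact: cf.
- by move=> x /ltW /dF[].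
- apply: cvg_at_right_filter.
  have [+ _] := dF a (lexx _).
  by move=> /derivable1_diffP/differentiable_continuous.
- move=> x; rewrite in_itv/= andbT => /ltW ax.
  by rewrite derive1E (@derive_val _ _ _ _ _ _ _ (dF x ax)).
Qed.

Lemma cvgr0_le_invr {R : realType} (f : R -> R) (C : R) :
  (forall x : R, 0 < x -> 0 <= f x <= C / x) -> f x @[x --> +oo] --> (0 : R).
Proof.
move=> fC; apply: (@squeeze_cvgr _ _ _ _ (cst 0) (fun x => C / x)).
- by near=> x; apply: fC; near: x; exact: nbhs_pinfty_gt.
- exact: cvg_cst.
- rewrite -(mulr0 C); apply: cvgMr; apply/gtr0_cvgV0; last exact: cvg_id.
  exact: nbhs_pinfty_gt.
Unshelve. all: by end_near. Qed.

Lemma integral_expRN {R : realType} (s a : R) : 0 < s ->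
  (\int[lebesgue_measure]_(z in `[a, +oo[) (expR (- (s * z)))%:E =
   (s^-1 * expR (- (s * a)))%:E)%E.
Proof.
move=> s0.
pose F (z : R) := - (s^-1 * expR (- (s * z))).
transitivity ((0 - F a)%:E); first apply: ge0_integral_is_derive; last first.
- by rewrite /F sub0r opprK.
- rewrite -oppr0 -(mulr0 s^-1); apply: cvgN; apply: cvgMr => //.
  apply: (@cvg_comp _ _ _ (fun z => s * z) (fun z => expR (- z)) _
    (pinfty_nbhs R)); last exact: cvgr_expR.
  exact: gt0_cvgMry.
- move=> x _; apply: is_derive_eq; rewrite /GRing.scale/=.
  by field; rewrite gt_eqF.
- move=> x _; apply: continuous_comp; last exact: continuous_expR.
  by apply: continuousN; apply: continuousM => //; exact: cst_continuous.
- by move=> x _; exact: expR_ge0.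
Qed.

Lemma integral_id_expRN {R : realType} (c : R) : 0 < c ->
  (\int[lebesgue_measure]_(x in `[0%R, +oo[) (x * expR (- (c * x)))%:E =
   (c ^- 2)%:E)%E.
Proof.
move=> c0.
pose F (x : R) := - ((x / c + c ^- 2) * expR (- (c * x))).
transitivity ((0 - F 0)%:E); first apply: ge0_integral_is_derive; last first.
- by rewrite /F mulr0 oppr0 expR0 mulr1 mul0r !add0r opprK.
- rewrite -oppr0; apply: cvgN.
  (* With y = c x, the quantity is y (y + 1) exp(- y) / (c^3 x), and y (y + 1) exp(- y) <= 3. *)
  apply: (@cvgr0_le_invr _ _ (3 / c ^+ 3)) => x x0.
  have cx0 : 0 < c * x by exact: mulr_gt0.
  apply/andP; split.
    by rewrite mulr_ge0 ?expR_ge0// addr_ge0 ?invr_ge0 ?exprn_ge0 ?divr_ge0//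
      ltW.
  rewrite expRN ler_pdivrMr ?expR_gt0//.
  (* y + y^2 <= 3 exp y at y = c x *)
  have := expR_ge1Dxn 1 (ltW cx0); have := expR_ge1Dx (c * x).
  rewrite (_ : 2`!%:R = 2)//; set e := expR _ => e1 e2.
  have e3 : (c * x) * (c * x + 1) <= 3 * e by nra.
  rewrite (_ : x / c + _ = (c * x) * (c * x + 1) / (c ^+ 3 * x)); last first.
    by field; rewrite !gt_eqF.
  rewrite (_ : _ / x * e = 3 * e / (c ^+ 3 * x)); last first.
    by field; rewrite !gt_eqF.
  by rewrite ler_pM2r// invr_gt0 mulr_gt0// exprn_gt0.
- move=> x _; apply: is_derive_eq; rewrite /GRing.scale/=.
  by field; rewrite gt_eqF.
- move=> x _; apply: continuousM => //.
  apply: continuous_comp; last exact: continuous_expR.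
  by apply: continuousN; apply: continuousM => //; exact: cst_continuous.
- by move=> x x0; rewrite mulr_ge0// expR_ge0.
Qed.

(** This integral is the source of the constant 3 in the threshold: an antiderivative is - (c^2 / 3)
    (c + z)^-3, which vanishes at infinity. *)
Lemma integral_inv_addX4 {R : realType} (c : R) : 0 < c ->
  (\int[lebesgue_measure]_(z in `[0%R, +oo[) ((c / (c + z) ^+ 2) ^+ 2)%:E =
   ((3 * c)^-1)%:E)%E.
Proof.
move=> c0.
have cz (z : R) : 0 <= z -> c + z != 0 by move=> z0; rewrite gt_eqF// ltr_pwDl.
pose F (z : R) := - (c ^+ 2 / 3 * ((c + z) ^+ 3)^-1).
transitivity ((0 - F 0)%:E); first apply: ge0_integral_is_derive; last first.
- by rewrite /F addr0 sub0r opprK; congr EFin; field; rewrite gt_eqF.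
- rewrite -oppr0; apply: cvgN; apply: (@cvgr0_le_invr _ _ (3^-1)) => x x0.
  have xc : 0 < c + x by rewrite addr_gt0.
  apply/andP; split.
    by rewrite mulr_ge0 ?invr_ge0 ?mulr_ge0 ?exprn_ge0 ?invr_ge0// ltW.
  rewrite ler_pdivlMr// mulrAC ler_pdivrMr ?exprn_gt0//.
  (* Up to the factor 1/3 the claim is c^2 x <= (c + x)^3; the expansion of the cube has positive
     terms only, among them 3 c^2 x. *)
  have c2x : 0 < c ^+ 2 * x by rewrite mulr_gt0// exprn_gt0.
  have cx2 : 0 < c * x ^+ 2 by rewrite mulr_gt0// exprn_gt0.
  have [c3 x3] : 0 < c ^+ 3 /\ 0 < x ^+ 3 by rewrite !exprn_gt0.
  by lra.
- move=> x x0; have := cz _ x0 => cx.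
  have dX : is_derive x 1 (fun z => (c + z) ^+ 3) (3 * (c + x) ^+ 2).
    by apply: is_derive_eq; rewrite /GRing.scale/= add0r; ring.
  have c3 : (c + x) ^+ 3 != 0 by rewrite expf_neq0.
  have dV := @is_deriveV R (fun z => (c + z) ^+ 3) x _ 1 c3 dX.
  by apply: is_derive_eq; rewrite /GRing.scale/=; field.
- move=> x x0; apply: (@continuous_comp _ _ _ (fun z : R => c / (c + z) ^+ 2)
    (fun y => y ^+ 2)); last exact: exprn_continuous.
  apply: continuousM; first exact: cst_continuous.
  apply: continuousV; first by rewrite sqrf_eq0 cz.
  apply: (@continuous_comp _ _ _ (fun z : R => c + z) (fun y => y ^+ 2));
    last exact: exprn_continuous.
  by apply: continuousD => //; exact: cst_continuous.
- by move=> x x0; exact: sqr_ge0.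
Qed.

(* The laws of the gaps are compared with Lebesgue measure, which lives on
   [measurableTypeR R] and not on [R] itself: the two have convertible
   measurable sets but different displays. *)
Lemma eq_measure_rays {R : realType}
    (m1 m2 : {measure set (measurableTypeR R) -> \bar R}) :
  (forall s : R, m1 `[s, +oo[%classic = m2 `[s, +oo[%classic) ->
  (m1 setT < +oo)%E ->
  forall A : set (measurableTypeR R), measurable A -> m1 A = m2 A.
Proof.
move=> m12 m1T A mA.
apply: (@measure_unique _ R (measurableTypeR R) (@RGenCInfty.G R)
  (fun n => [set` `[- n%:R, +oo[%R])) => //.
- exact: RGenCInfty.measurableE.
- move=> _ _ [s ->] [u ->]; exists (Num.max s u).
  by apply/seteqP; split => x /=; rewrite !in_itv/= !andbT ge_max => /andP.
- by move=> n; exists (- n%:R).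
- apply/seteqP; split => // x _; exists (Num.truncn `|x|).+1 => //=.
  rewrite in_itv/= andbT lerNl (le_trans (ler_norm _))// normrN ltW//.
  exact: truncnS_gt.
- by move=> _ [s ->].
- by move=> k; apply: le_lt_trans m1T; apply: le_measure; rewrite ?inE.
Qed.

(** * Independence of real random variables tested on upper rays *)

Section independence_from_rays.
Context {R : realType} d (T : measurableType d) (P : probability T R).

Lemma measurable_preimage (X : {RV P >-> measurableTypeR R})
    (A : set (measurableTypeR R)) :
  measurable A -> measurable (X @^-1` A).
Proof.
by move=> mA; rewrite -[X in measurable X]setTI; exact: measurable_funP.
Qed.

(** For fixed E both sides are finite measures in A: the image under X of P restricted to E, and the
    law of X scaled by P E. Finite measures that agree on upper rays are equal. *)
Lemma eq_probI_rays (X : {RV P >-> measurableTypeR R}) (E : set T) :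
  measurable E ->
  (forall s : R, P (X @^-1` `[s, +oo[%classic `&` E) =
                 P (X @^-1` `[s, +oo[%classic) * P E)%E ->
  forall A : set (measurableTypeR R), measurable A ->
    P (X @^-1` A `&` E) = (P (X @^-1` A) * P E)%E.
Proof.
move=> mE XE A mA.
have PE0 : (0 <= fine (P E)) by rewrite fine_ge0.
have PEE : (P E) = (fine (P E))%:E by rewrite fineK// fin_num_measure.
pose m1' := [the measure _ _ of pushforward (mrestr P mE) X].
pose m1 := m1' (measurable_funPT X).
pose m2 := mscale (NngNum PE0) (distribution P X).
have m2E B : m2 B = (P (X @^-1` B) * P E)%E by rewrite [in RHS]PEE muleC.
apply: etrans (m2E A); apply: (@eq_measure_rays _ m1 m2) => //.
- by move=> s; apply: etrans (esym (m2E _)); exact: XE.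
- apply: (@le_lt_trans _ _ 1%E); last exact: ltry.
  by apply: probability_le1; rewrite preimage_setT setTI.
Qed.

(** Rays are replaced by arbitrary measurable sets one variable at a time, by [eq_probI_rays] with E
    a preimage under the other variable. *)
Lemma independent_rays (X Y : {RV P >-> measurableTypeR R}) :
  (forall s u : R, P (X @^-1` `[s, +oo[%classic `&` Y @^-1` `[u, +oo[%classic) =
    P (X @^-1` `[s, +oo[%classic) * P (Y @^-1` `[u, +oo[%classic))%E ->
  forall A B : set (measurableTypeR R), measurable A -> measurable B ->
    P (X @^-1` A `&` Y @^-1` B) = (P (X @^-1` A) * P (Y @^-1` B))%E.
Proof.
move=> XY A B mA mB; apply: eq_probI_rays => //.
  exact: measurable_preimage.
move=> s; rewrite setIC muleC; apply: eq_probI_rays => // [|u].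
  exact: measurable_preimage.
by rewrite setIC muleC.
Qed.

(** The product rule identifies the joint law of X and Y with the product of their laws; Tonelli's
    theorem then splits the integral. *)
Lemma ge0_expectationM_independent (X Y : {RV P >-> measurableTypeR R})
    (f g : measurableTypeR R -> R) :
  (forall A B : set (measurableTypeR R), measurable A -> measurable B ->
    P (X @^-1` A `&` Y @^-1` B) = (P (X @^-1` A) * P (Y @^-1` B))%E) ->
  measurable_fun setT f -> measurable_fun setT g ->
  (forall r, 0 <= f r) -> (forall r, 0 <= g r) ->
  (\int[P]_w (f (X w) * g (Y w))%:E =
   (\int[P]_w (f (X w))%:E) * (\int[P]_w (g (Y w))%:E))%E.
Proof.
move=> XY mf mg f0 g0.
have mXY : measurable_fun setT (fun w => (X w, Y w)).
  exact: measurable_fun_pair.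
pose h := fun z : measurableTypeR R * measurableTypeR R => (f z.1 * g z.2)%:E.
have mh : measurable_fun setT h.
  by apply/measurable_EFinP; apply: measurable_funM; exact: measurableT_comp.
have h0 z : (0 <= h z)%E by rewrite lee_fin mulr_ge0.
transitivity (\int[pushforward P (fun w => (X w, Y w))]_z h z)%E.
  by rewrite ge0_integral_pushforward.
transitivity (\int[distribution P X \x distribution P Y]_z h z)%E.
  apply: eq_measure_integral => A mA _; apply/esym.
  by apply: product_measure_unique => // B C mB mC; exact: XY.
rewrite fubini_tonelli1// /fubini_F.
have mfX : measurable_fun setT (EFin \o f) by exact/measurable_EFinP.
have mgY : measurable_fun setT (EFin \o g) by exact/measurable_EFinP.
rewrite -(@ge0_integral_distribution _ _ _ _ _ P X (EFin \o f))//.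
rewrite -(@ge0_integral_distribution _ _ _ _ _ P Y (EFin \o g))//.
rewrite -ge0_integralZr//; last 2 first.
- by move=> y _; rewrite lee_fin.
- by apply: integral_ge0 => y _; rewrite lee_fin.
apply: eq_integral => y _; rewrite -ge0_integralZl//; last 2 first.
- by move=> z _; rewrite lee_fin.
- by rewrite lee_fin.
Qed.

End independence_from_rays.

(** * The exponential law: mass of rays, uniqueness, integration against the density *)

Section exponential_law.
Context {R : realType} {lambda : R}.
Hypothesis lambda_gt0 : 0 < lambda.

(** The density vanishes on the negative half-line, so a ray that starts below 0 has the mass of the
    ray from 0; [Num.max s 0] covers both cases. *)
Lemma exponential_prob_ray (s : R) :
  exponential_prob lambda `[s, +oo[%classic =
  (expR (- (lambda * Num.max s 0)))%:E.
Proof.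
transitivity (\int[lebesgue_measure]_(r in `[(Num.max s 0)%R, +oo[)
    (exponential_pdf lambda r)%:E)%E.
  rewrite /exponential_prob integral_mkcond [RHS]integral_mkcond.
  apply: eq_integral => r _; rewrite !patchE.
  case: ifPn => rs; case: ifPn => rs' //.
  - move: rs rs'.
    rewrite !inE/= notin_setE/= !in_itv/= !andbT ge_max => -> /negP.
    by rewrite -ltNge => r0; rewrite lt0_exponential_pdf.
  - move: rs rs'; rewrite !inE/= notin_setE/= !in_itv/= !andbT ge_max.
    by move=> + /andP[sr _]; rewrite sr.
have m0 : 0 <= (Num.max s 0)%R by rewrite le_max lexx orbT.
transitivity (lambda%:E * \int[lebesgue_measure]_(r in `[(Num.max s 0)%R, +oo[)
    (expR (- (lambda * r)))%:E)%E.
  rewrite -ge0_integralZl//; last 2 first.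
  - apply/measurable_EFinP/measurable_funTS; apply: measurableT_comp => //.
    by apply: measurable_funN; exact: measurable_funM.
  - by rewrite lee_fin ltW.
  apply: eq_integral => r; rewrite inE/= in_itv/= andbT => sr.
  by rewrite exponential_pdfE ?(le_trans m0)// mulNr EFinM.
by rewrite integral_expRN// -EFinM mulrA divff ?gt_eqF// mul1r.
Qed.

Lemma exponential_prob_unique (m : probability (measurableTypeR R) R) :
  (forall s : R, m `[s, +oo[%classic = (expR (- (lambda * Num.max s 0)))%:E) ->
  forall A : set (measurableTypeR R), measurable A ->
    m A = exponential_prob lambda A.
Proof.
move=> mray A mA.
pose E :=
  exponential_distribution_exponential_prob__canonical__probability_measure_Probability
  lambda_gt0.
refine (@eq_measure_rays _ m E _ _ A mA); last first.
  exact: le_lt_trans (probability_le1 m measurableT) (ltry 1).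
by move=> s; exact: etrans (mray s) (esym (exponential_prob_ray s)).
Qed.

(** m is absolutely continuous, and its Radon-Nikodym derivative equals the exponential density
    almost everywhere because both have the same integral over every measurable set. *)
Lemma ge0_integral_exponential (m : probability (measurableTypeR R) R)
    (f : measurableTypeR R -> R) :
  (forall A : set (measurableTypeR R), measurable A ->
    m A = exponential_prob lambda A) ->
  measurable_fun setT f -> (forall r, 0 <= f r) ->
  (\int[m]_r (f r)%:E = \int[lebesgue_measure]_(r in `[0%R, +oo[)
     (lambda * (f r * expR (- (lambda * r))))%:E)%E.
Proof.
move=> mE mf f0.
have mf' : measurable_fun setT (EFin \o f) by exact/measurable_EFinP.
have mp : measurable_fun setT (EFin \o exponential_pdf lambda).
  by apply/measurable_EFinP; exact: measurable_exponential_pdf.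
have ml : m `<< (@lebesgue_measure R).
  apply/null_content_dominatesP => A mA A0.
  rewrite mE//; apply: null_set_integral => //; exact: measurable_funTS.
rewrite -(Radon_Nikodym_SigmaFinite.change_of_variables ml)//.
transitivity (\int[lebesgue_measure]_r (f r * exponential_pdf lambda r)%:E)%E.
  under [RHS]eq_integral do rewrite EFinM.
  apply: ae_eq_integral => //.
  - apply: emeasurable_funM => //.
    exact: measurable_int (Radon_Nikodym_SigmaFinite.f_integrable ml).
  - exact: emeasurable_funM.
  - apply: (@ae_eqe_mul2l _ _ _ _ _ _ _ (EFin \o f)).
    apply: integral_ae_eq => //.
      exact: Radon_Nikodym_SigmaFinite.f_integrable.
    move=> A _ mA; rewrite -Radon_Nikodym_SigmaFinite.f_integral//.
    exact: mE.
rewrite [RHS]integral_mkcond; apply: eq_integral => r _; rewrite patchE.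
case: ifPn => r0; rewrite ?inE/= ?notin_setE/= in_itv/= andbT in r0.
  by rewrite exponential_pdfE// mulNr mulrCA.
by rewrite lt0_exponential_pdf ?mulr0// ltNge; apply/negP.
Qed.

End exponential_law.

(** * Expectation of X Y / (X + Y) for independent exponential variables *)

Section harmonic_expectation.
Context {R : realType} d (T : measurableType d) (P : probability T R).
Context (lambda : R) (X Y : {RV P >-> measurableTypeR R}).
Hypothesis lambda_gt0 : 0 < lambda.
Hypothesis X_exp : forall s : R,
  P (X @^-1` `[s, +oo[%classic) = (expR (- (lambda * Num.max s 0)))%:E.
Hypothesis Y_exp : forall s : R,
  P (Y @^-1` `[s, +oo[%classic) = (expR (- (lambda * Num.max s 0)))%:E.
Hypothesis XY_indep : forall s u : R,
  P (X @^-1` `[s, +oo[%classic `&` Y @^-1` `[u, +oo[%classic) =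
  (P (X @^-1` `[s, +oo[%classic) * P (Y @^-1` `[u, +oo[%classic))%E.

(** The factor r exp(- z r) of the integral representation of X Y / (X + Y), evaluated at the
    positive part of r. *)
Let phi (z r : R) := Num.max r 0 * expR (- (z * Num.max r 0)).

Let phi_ge0 z r : 0 <= phi z r.
Proof. by rewrite /phi mulr_ge0 ?expR_ge0// le_max lexx orbT. Qed.

Let measurable_max0 :
  measurable_fun setT (fun r : measurableTypeR R => Num.max r 0).
Proof. exact: measurable_maxr. Qed.

Let measurable_phi z : measurable_fun setT (phi z : measurableTypeR R -> R).
Proof.
apply: measurable_funM; first exact: measurable_max0.
apply: measurableT_comp => //; apply: measurable_funN.
by apply: measurable_funM => //; exact: measurable_max0.
Qed.

Let expectation_phi (Z : {RV P >-> measurableTypeR R}) (z : R) : 0 <= z ->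
  (forall s : R,
    P (Z @^-1` `[s, +oo[%classic) = (expR (- (lambda * Num.max s 0)))%:E) ->
  (\int[P]_w (phi z (Z w))%:E = (lambda / (lambda + z) ^+ 2)%:E)%E.
Proof.
move=> z0 Z_exp.
have lz : 0 < lambda + z by rewrite ltr_pwDl.
have mphi : measurable_fun setT (EFin \o (phi z : measurableTypeR R -> R)).
  by apply/measurable_EFinP; exact: measurable_phi.
rewrite -(@ge0_integral_distribution _ _ _ _ _ P Z _ mphi)//; last first.
  by move=> r; rewrite lee_fin.
rewrite (@ge0_integral_exponential _ lambda)//; last first.
  exact: (exponential_prob_unique lambda_gt0).
(* The factor exp(- z r) merges with the density and raises the rate to lambda + z. *)
transitivity (lambda%:E * \int[lebesgue_measure]_(r in `[0%R, +oo[)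
    (r * expR (- ((lambda + z) * r)))%:E)%E.
  rewrite -ge0_integralZl//; last 3 first.
  - apply/measurable_EFinP/measurable_funTS; apply: measurable_funM => //.
    apply: measurableT_comp => //; apply: measurable_funN.
    exact: measurable_funM.
  - move=> r /=; rewrite in_itv/= andbT => r0.
    by rewrite lee_fin mulr_ge0 ?expR_ge0.
  - by rewrite lee_fin ltW.
  apply: eq_integral => r; rewrite inE/= in_itv/= andbT => r0.
  rewrite -EFinM /phi max_l// -mulrA -expRD; congr (lambda * (r * expR _))%:E.
  by ring.
by rewrite integral_id_expRN.
Qed.

(* The positive parts only matter on a null event; they make the integrand
   nonnegative everywhere, as Tonelli's theorem requires. *)
Lemma expectation_harmonic :
  (\int[P]_w ((Num.max (X w) 0 * Num.max (Y w) 0) /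
              (Num.max (X w) 0 + Num.max (Y w) 0))%:E = ((3 * lambda)^-1)%:E)%E.
Proof.
have indep := independent_rays XY_indep.
pose D : set (measurableTypeR R) := `[0%R, +oo[%classic.
have mD : measurable D by exact: measurable_itv.
(* The indicator carries the domain z >= 0, so that Tonelli's theorem applies on the full product
   space. *)
pose F (p : T * measurableTypeR R) :=
  (phi p.2 (X p.1) * phi p.2 (Y p.1) * \1_D p.2)%:E.
have mF : measurable_fun setT F.
  apply/measurable_EFinP.
  have mphi (Z : {RV P >-> measurableTypeR R}) :
      measurable_fun setT (fun p : T * measurableTypeR R => phi p.2 (Z p.1)).
    have mZ : measurable_fun setT
        (fun p : T * measurableTypeR R => Num.max (Z p.1) 0).
      apply: (measurableT_comp measurable_max0).
      exact: measurableT_comp.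
    apply: measurable_funM; first exact: mZ.
    apply: measurableT_comp => //; apply: measurable_funN.
    by apply: measurable_funM; [exact: measurable_snd|exact: mZ].
  apply: measurable_funM; first exact: measurable_funM.
  exact: measurableT_comp.
have F0 p : (0 <= F p)%E.
  by rewrite lee_fin; apply: mulr_ge0; [exact: mulr_ge0|rewrite indicE].
transitivity (\int[P]_w \int[lebesgue_measure]_z F (w, z))%E.
  apply: eq_integral => w _; rewrite /F/=.
  set a := Num.max (X w) 0; set b := Num.max (Y w) 0.
  have a0 : 0 <= a by rewrite le_max lexx orbT.
  have b0 : 0 <= b by rewrite le_max lexx orbT.
  transitivity (\int[lebesgue_measure]_(z in D)
      ((a * b)%:E * (expR (- ((a + b) * z)))%:E))%E; last first.
    rewrite [LHS]integral_mkcond; apply: eq_integral => z _.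
    rewrite patchE indicE; case: ifPn => _; last by rewrite mulr0.
    rewrite mulr1 -EFinM /phi mulrACA -expRD; congr (a * b * expR _)%:E.
    by rewrite -/a -/b; ring.
  (* If a + b = 0, the integral of exp(- (a + b) z) diverges, but a = 0 and both sides vanish. *)
  have [ab0|ab0] := eqVneq (a + b) 0.
    have -> : a = 0 by lra.
    rewrite !mul0r; under eq_integral do rewrite mul0e.
    by rewrite integral0.
  have ab : 0 < a + b by rewrite lt_neqAle eq_sym ab0 addr_ge0.
  rewrite ge0_integralZl//; last 2 first.
  - apply/measurable_EFinP/measurable_funTS; apply: measurableT_comp => //.
    by apply: measurable_funN; exact: measurable_funM.
  - by rewrite lee_fin mulr_ge0.
  by rewrite /D integral_expRN// mulr0 oppr0 expR0 mulr1 -EFinM.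
(* After the exchange z is fixed, and independence turns the inner expectation into the square of
   lambda / (lambda + z)^2. *)
rewrite (@fubini_tonelli _ _ _ _ _ P lebesgue_measure F)//.
rewrite -integral_inv_addX4// [RHS]integral_mkcond; apply: eq_integral => z _.
rewrite patchE; case: ifPn => zD; rewrite /F/=.
  have zD' : (z \in D) = true by [].
  under eq_integral do rewrite indicE zD' mulr1.
  have z0 : 0 <= z by move: zD; rewrite inE/= in_itv/= andbT.
  rewrite (ge0_expectationM_independent indep)//; [|exact: measurable_phi..].
  by rewrite !expectation_phi// -EFinM expr2.
have zD' : (z \in D) = false by exact: negbTE.
under eq_integral do rewrite indicE zD' mulr0.
by rewrite integral0.
Qed.

End harmonic_expectation.

(** * Void probabilities and conditioning on the grid cell of the task *)

Lemma npoints_eq0 {R : realType} (T : Type) (Xi : T -> set R) (A : set R)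
    (w : T) :
  (counting (Xi w `&` A) = 0 :> \bar R)%E <-> Xi w `&` A = set0.
Proof.
rewrite /counting; split => [|->].
  case: ifPn => // /asboolP fin [] /eqP; rewrite pnatr_eq0 => /eqP.
  by move=> /finmap.cardfs0_eq; exact: fset_set_set0.
by rewrite asboolT// fset_set0.
Qed.

(** Law of total probability: a bound relative to each cell sums to a bound on E. The part of E
    outside the cells is absorbed by the null complement of their union. *)
Lemma prob_le_partition {R : realType} d (T : measurableType d)
    (P : probability T R) (I : nat -> set T) (E : set T) (c : R) :
  (forall k, measurable (I k)) -> trivIset setT I -> P (\bigcup_k I k) = 1%E ->
  measurable E -> 0 <= c ->
  (forall k, P (E `&` I k) <= c%:E * P (I k))%E -> (P E <= c%:E)%E.
Proof.
move=> mI tI PI mE c0 Ec.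
have mU : measurable (\bigcup_k I k) by exact: bigcupT_measurable.
have PS : (\sum_(k <oo) P (I k) = 1)%E.
  exact: etrans (esym (measure_semi_bigcup P mI tI mU)) PI.
have PC : P (~` \bigcup_k I k) = 0%E by rewrite probability_setC// PI subee.
have EI k : measurable (E `&` I k) by exact: measurableI.
apply: (@le_trans _ _ (P ((E `&` \bigcup_k I k) `|` ~` \bigcup_k I k))).
  apply: le_measure; rewrite ?inE//.
    by apply: measurableU; [exact: measurableI|exact: measurableC].
  by move=> w Ew; have [?|?] := pselect ((\bigcup_k I k) w); [left|right].
rewrite measureU0//; [|exact: measurableI|exact: measurableC].
rewrite setI_bigcupr measure_semi_bigcup//; last 2 first.
- exact: trivIset_setIl.
- exact: bigcupT_measurable.
apply: (@le_trans _ _ (\sum_(k <oo) (c%:E * P (I k)))%E).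
  by apply: lee_nneseries => [k _ _|k _]; [exact: measure_ge0|exact: Ec].
by rewrite nneseriesZl// PS mule1.
Qed.

Lemma prob_ge_partition {R : realType} d (T : measurableType d)
    (P : probability T R) (I : nat -> set T) (E : set T) (c : R) :
  (forall k, measurable (I k)) -> trivIset setT I -> P (\bigcup_k I k) = 1%E ->
  measurable E -> 0 <= c ->
  (forall k, c%:E * P (I k) <= P (E `&` I k))%E -> (c%:E <= P E)%E.
Proof.
move=> mI tI PI mE c0 Ec.
have mU : measurable (\bigcup_k I k) by exact: bigcupT_measurable.
have PS : (\sum_(k <oo) P (I k) = 1)%E.
  exact: etrans (esym (measure_semi_bigcup P mI tI mU)) PI.
have EI k : measurable (E `&` I k) by exact: measurableI.
apply: (@le_trans _ _ (P (E `&` \bigcup_k I k))); last first.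
  by apply: le_measure; rewrite ?inE//; exact: measurableI.
rewrite setI_bigcupr measure_semi_bigcup//; last 2 first.
- exact: trivIset_setIl.
- exact: bigcupT_measurable.
rewrite -[leLHS]mule1 -PS -nneseriesZl//.
by apply: lee_nneseries => // k _ _; rewrite mule_ge0.
Qed.

Definition void_event {R : realType} {T : Type} (Xi : T -> set R) (A : set R) :
  set T := [set w | Xi w `&` A = set0].

Section poisson_voids.
Context {R : realType} {d : measure_display} {T : measurableType d}.
Context {P : probability T R} {lambda : R} {a b : R} {ab : a < b}.
Context {Xi : T -> set R} {x : {RV P >-> R}}.
Hypothesis lambda_gt0 : 0 < lambda.
Hypothesis HXi : homogeneous_poisson P lambda Xi.
Hypothesis Hx : uniform_on ab x.
Hypothesis Hindep : independent_of_process Xi x.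

Local Notation void := (void_event Xi).

Lemma void_npoints A : void A = npoints Xi A @^-1` [set 0%E].
Proof. by apply/seteqP; split => w /npoints_eq0. Qed.

Lemma measurable_void (A : set R) : measurable A -> measurable (void A).
Proof.
move=> mA; rewrite void_npoints -[X in measurable X]setTI.
have [[_ mXi] _ _] := HXi.
exact: mXi.
Qed.

Lemma prob_void_itv (c e : R) : c <= e ->
  P (void `]c, e[) = (expR (- (lambda * (e - c))))%:E.
Proof.
move=> ce; have mce : measurable `]c, e[%classic by exact: measurable_itv.
have [_ /(_ `]c, e[%classic mce) + _] := HXi.
have -> : lebesgue_measure `]c, e[%classic = (e - c)%:E :> \bar R.
  rewrite lebesgue_measure_itv/= lte_fin -EFinB; case: ltP => // ec.
  by rewrite (_ : e = c) ?subrr//; apply/le_anti; rewrite ec.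
move=> /(_ (ltry _) 0%N).
have -> : [set w | npoints Xi `]c, e[ w = 0%:R%:E] = void `]c, e[.
  by rewrite void_npoints.
move=> ->; rewrite /poisson_prob/=; case: ltP => [l0|l0].
  rewrite esum_set1 ?lee_fin ?poisson_pmf_ge0// /poisson_pmf l0.
  by rewrite expr0 mul1r fact0 invr1 mul1r.
(* Degenerate case: the mean is 0, and the Poisson law is the Dirac mass at 0. *)
have -> : lambda * (e - c) = 0.
  by apply/le_anti; rewrite l0 mulr_ge0 ?subr_ge0// ltW.
by rewrite oppr0 expR0 diracE mem_set.
Qed.

(** Independence of the task enters here: a void event is the event that a count is 0, hence a
    generator of the sigma-algebra of the process. *)
Lemma prob_voidI (A B : set R) : measurable A -> measurable B ->
  P (void A `&` x @^-1` B) = (P (void A) * P (x @^-1` B))%E.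
Proof.
move=> mA mB; apply: Hindep => //; apply: sub_sigma_algebra.
exists A => //; exists [set 0%E]; first exact: emeasurable_set1.
by rewrite setTI void_npoints.
Qed.

(** Grid cells of mesh e start at the left end a of the task's range, so natural indices suffice to
    cover it almost surely. *)
Let I (e : R) (k : nat) : set T := x @^-1` `[a + k%:R * e, a + k.+1%:R * e[.

Let mI e k : measurable (I e k).
Proof. by rewrite -[X in measurable X]setTI; exact: measurable_funPT. Qed.

Let IP e k w : I e k w -> a + k%:R * e <= x w < a + k.+1%:R * e.
Proof. by rewrite /I/= in_itv. Qed.

Let tI e : 0 < e -> trivIset setT (I e).
Proof.
move=> e0; apply/trivIsetP => i j _ _; rewrite neq_lt => nij.
wlog ij : i j nij / (i < j)%N.
  move=> H; case/orP: (nij) => ij; first exact: H.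
  by rewrite setIC; apply: H => //; rewrite orbC.
apply/seteqP; split => // w [/IP/andP[_ wi] /IP/andP[wj _]].
have := le_lt_trans wj wi; rewrite ltrD2l ltr_pM2r// ltr_nat ltnS.
by rewrite leqNgt ij.
Qed.

Let PI e : 0 < e -> P (\bigcup_k I e k) = 1%E.
Proof.
move=> e0.
have -> : \bigcup_k I e k = x @^-1` `[a, +oo[.
  apply/seteqP; split => w.
    move=> [k _ /IP/andP[kx _]]; rewrite /= in_itv/= andbT.
    by rewrite (le_trans _ kx)// lerDl mulr_ge0// ltW.
  rewrite /= in_itv/= andbT => ax; exists (Num.truncn ((x w - a) / e)) => //.
  have xa0 : 0 <= (x w - a) / e by rewrite divr_ge0 ?subr_ge0// ltW.
  rewrite /I/= in_itv/= -lerBrDl -ltrBlDl -ler_pdivlMr// -ltr_pdivrMr//.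
  by rewrite truncn_le xa0 truncnS_gt.
have -> : P (x @^-1` `[a, +oo[) = distribution P x `[a, +oo[ by [].
rewrite Hx; last exact: measurable_itv.
rewrite /uniform_prob integral_uniform_pdf1// => r.
by rewrite /= !in_itv/= andbT => /andP[].
Qed.

(* The two following lemmas condition on the cell [[a + k e, a + (k + 1) e[] of
   the task. *)
Lemma prob_le_void (E : set T) (e m : R) (l r : nat -> R) :
  measurable E -> 0 < e ->
  (forall k, l k + m <= r k) ->
  (forall k w, E w -> a + k%:R * e <= x w < a + k.+1%:R * e ->
    void `]l k, r k[ w) ->
  (P E <= (expR (- (lambda * m)))%:E)%E.
Proof.
(* For negative m the bound is at least 1, hence trivial; for m >= 0 the intervals satisfy l k <= r
   k, as [prob_void_itv] requires. *)
move=> mE e0 lr Ev; have [m0|m0] := leP 0 m; last first.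
  apply: le_trans (probability_le1 P mE) _.
  by rewrite lee_fin -expR0 ler_expR oppr_ge0 pmulr_rle0// ltW.
apply: (@prob_le_partition _ _ _ _ (I e)) => //; [exact: tI|exact: PI|].
move=> k; have mlr : measurable `]l k, r k[%classic by exact: measurable_itv.
apply: (@le_trans _ _ (P (void `]l k, r k[ `&` I e k))).
  apply: le_measure; rewrite ?inE; [exact: measurableI| |].
    by apply: measurableI => //; exact: measurable_void.
  by move=> w [Ew Iw]; split => //; apply: (Ev k) => //; exact: IP.
rewrite prob_voidI//.
apply: lee_wpmul2r => //; rewrite prob_void_itv; last first.
  by rewrite (le_trans _ (lr k))// lerDl.
by rewrite lee_fin ler_expR lerN2 ler_pM2l// lerBrDl.
Qed.

Lemma prob_ge_void (E : set T) (e m : R) (l r : nat -> R) :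
  measurable E -> 0 < e ->
  (forall k, l k <= r k <= l k + m) ->
  (forall k w, void `]l k, r k[ w -> a + k%:R * e <= x w < a + k.+1%:R * e ->
    E w) ->
  ((expR (- (lambda * m)))%:E <= P E)%E.
Proof.
move=> mE e0 lr Ev.
apply: (@prob_ge_partition _ _ _ _ (I e)) => //; [exact: tI|exact: PI|].
move=> k; have mlr : measurable `]l k, r k[%classic by exact: measurable_itv.
apply: (@le_trans _ _ (P (void `]l k, r k[ `&` I e k))); last first.
  apply: le_measure; rewrite ?inE; [|exact: measurableI|].
    by apply: measurableI => //; exact: measurable_void.
  by move=> w [Ew Iw]; split => //; apply: (Ev k) => //; exact: IP.
rewrite prob_voidI//.
have /andP[lr1 lr2] := lr k.
apply: lee_wpmul2r => //; rewrite prob_void_itv//.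
by rewrite lee_fin ler_expR lerN2 ler_pM2l// lerBlDl.
Qed.

End poisson_voids.

(** * Measurability and almost sure existence of the neighbouring knowledge points *)

Lemma measurable_invr {R : realType} :
  measurable_fun setT (GRing.inv : R -> R).
Proof.
(* This form reduces the claim to a real power with nonnegative base; at t = 0 both sides are 0. *)
have -> : GRing.inv = (fun t : R => t * (t ^+ 2) `^ (-1)).
  apply/funext => t; rewrite powR_inv1 ?sqr_ge0//.
  have [->|t0] := eqVneq t 0; first by rewrite invr0 mul0r.
  by rewrite expr2 invfM mulrA divff// mul1r.
apply: measurable_funM => //.
apply: (measurableT_comp (@measurable_powR R (-1))).
by apply: measurable_funX.
Qed.

(** If S had no point in [p, t], the finite, hence closed, set of its points in [p, t + 1] would
    miss a neighbourhood of t, against the hypothesis at a rational slightly above t. This lets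
    rational endpoints replace the random task. *)
Lemma locally_finite_attained {R : realType} (S : set R) (p t : R) :
  locally_finite S ->
  (forall q : rat, t < ratr q -> exists2 y, S y & p <= y <= ratr q) ->
  exists2 y, S y & p <= y <= t.
Proof.
move=> fS Sq; apply: contrapT => noy.
pose F := S `&` `[p, t + 1].
have cF : closed F.
  have /accessible_finite_set_closed : accessible_space R.
    by apply: hausdorff_accessible; exact: norm_hausdorff.
  by apply; exact: fS.
have : nbhs t (~` F).
  apply: open_nbhs_nbhs; split; first exact: closed_openC.
  move=> [St]; rewrite /= in_itv/= => /andP[pt _]; apply: noy.
  by exists t => //; rewrite pt lexx.
move=> /nbhs_ballP[e /= e0 eF].
have /rat_in_itvoo[q] : t < Num.min (t + e) (t + 1).
  by rewrite lt_min !ltrDl e0/=.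
rewrite in_itv/= lt_min => /andP[tq /andP[qe q1]].
have [y Sy /andP[py yq]] := Sq q tq.
have [yt|ty] := leP y t; first by apply: noy; exists y => //; rewrite py.
apply: (eF y).
  by rewrite /ball/= ltr0_norm ?subr_lt0// opprB ltrBlDl (le_lt_trans yq).
by split => //; rewrite /= in_itv/= py (le_trans yq)// ltW.
Qed.

Section neighbours.
Context {R : realType} {d : measure_display} {T : measurableType d}.
Context {P : probability T R} {lambda : R} {a b : R} {ab : a < b}.
Context {Xi : T -> set R} {x : {RV P >-> R}}.
Hypothesis lambda_gt0 : 0 < lambda.
Hypothesis HXi : homogeneous_poisson P lambda Xi.
Hypothesis Hx : uniform_on ab x.
Hypothesis Hindep : independent_of_process Xi x.

Local Notation l w := (left_knowledge_point (Xi w) (x w)).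
Local Notation r w := (right_knowledge_point (Xi w) (x w)).

Let measurable_x (i : interval R) : measurable (x @^-1` [set` i]).
Proof.
rewrite -[X in measurable X]setTI.
by apply: measurable_funPT => //; exact: measurable_itv.
Qed.

(* The task is random, so these events are reduced to void events of
   deterministic intervals with rational endpoints. *)
Let hit_le (p : R) : set T := [set w | exists2 y, Xi w y & p <= y <= x w].
Let hit_gt (c : R) : set T := [set w | exists2 y, Xi w y & x w < y < c].
Let has_left : set T := [set w | exists2 y, Xi w y & y <= x w].
Let has_right : set T := [set w | exists2 y, Xi w y & x w < y].

Let measurable_hit_le p : measurable (hit_le p).
Proof.
(* There is no point in [p, x] exactly when [p, q] is void for some rational q > x. *)
have -> : hit_le p = ~` \bigcup_(q : rat)
    (x @^-1` `]-oo, ratr q[ `&` void_event Xi `[p, ratr q]).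
  apply/seteqP; split => w.
    move=> [y Xy /andP[py yx]] [q _ [/=]]; rewrite in_itv/= => xq vq.
    have : (Xi w `&` `[p, ratr q]) y.
      by split => //; rewrite /= in_itv/= py (le_trans yx)// ltW.
    by rewrite vq.
  move=> nw; apply: locally_finite_attained; first by have [[]] := HXi.
  move=> q xq; apply: contrapT => noy; apply: nw; exists q => //; split.
    by rewrite /= in_itv.
  apply/seteqP; split => // y [Xy]; rewrite /= in_itv/= => pyq.
  by apply: noy; exists y.
apply: measurableC; apply: bigcupT_measurable_rat => q.
apply: measurableI => //.
by apply: (measurable_void HXi); exact: measurable_itv.
Qed.

Let measurable_hit_gt c : measurable (hit_gt c).
Proof.
(* A point y with x < y < c is enclosed by rationals x < p < y < q < c. *)
have -> : hit_gt c = \bigcup_(p : rat) \bigcup_(q : rat)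
    if ratr q < c then
      x @^-1` `]-oo, ratr p[ `&` ~` void_event Xi `[ratr p, ratr q] else set0.
  apply/seteqP; split => w.
    move=> [y Xy /andP[/rat_in_itvoo[p] + /rat_in_itvoo[q]]].
    rewrite !in_itv/= => /andP[xp py] /andP[yq qc].
    exists p => //; exists q => //; rewrite qc.
    split; first by rewrite /= in_itv.
    move=> v; have : (Xi w `&` `[ratr p, ratr q]) y.
      by split => //; rewrite /= in_itv/= !ltW.
    by rewrite v.
  move=> [p _ [q _]]; case: ifPn => // qc [/=]; rewrite in_itv/= => xp.
  move=> /eqP/set0P[y [Xy]]; rewrite /= in_itv/= => /andP[py yq].
  by exists y => //; rewrite (lt_le_trans xp)// (le_lt_trans yq).
apply: bigcupT_measurable_rat => p; apply: bigcupT_measurable_rat => q.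
case: ifPn => // _; apply: measurableI => //; apply: measurableC.
by apply: (measurable_void HXi); exact: measurable_itv.
Qed.

Let measurable_has_left : measurable has_left.
Proof.
have -> : has_left = \bigcup_(n : nat) hit_le (- n%:R).
  apply/seteqP; split => w.
    move=> [y Xy yx]; exists (Num.truncn `|y|).+1 => //; exists y => //.
    by rewrite yx andbT lerNl (le_trans (ler_norm _))// normrN ltW// truncnS_gt.
  by move=> [n _ [y Xy /andP[_ yx]]]; exists y.
exact: bigcupT_measurable.
Qed.

Let measurable_has_right : measurable has_right.
Proof.
have -> : has_right = \bigcup_(n : nat) hit_gt n%:R.
  apply/seteqP; split => w.
    move=> [y Xy yx]; exists (Num.truncn `|y|).+1 => //; exists y => //.
    by rewrite yx/= (le_lt_trans (ler_norm _))// truncnS_gt.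
  by move=> [n _ [y Xy /andP[yx _]]]; exists y.
exact: bigcupT_measurable.
Qed.

Let le_left w y : Xi w y -> y <= x w -> y <= l w.
Proof. by move=> Xy yx; apply: ub_le_sup => //; exists (x w) => z []. Qed.

Let ge_right w y : Xi w y -> x w < y -> r w <= y.
Proof. by move=> Xy yx; apply: ge_inf => //; exists (x w) => z [_ /ltW]. Qed.

Lemma measurable_left : measurable_fun setT (fun w => l w).
Proof.
apply: (@measurability _ _ T (measurableTypeR R) _ _ _
  (RGenOInfty.measurableE R)) => _ [_ [c ->] <-].
rewrite setTI.
(* The supremum exceeds c when some point does, with a rational p between them. With no point on the
   left, the supremum is 0 by default, which exceeds c only if c < 0. *)
have -> : (fun w => l w) @^-1` `]c, +oo[ =
    (\bigcup_(p : rat) if c < ratr p then hit_le (ratr p) else set0) `|`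
    (if c < 0 then ~` has_left else set0).
  apply/seteqP; split => w.
    rewrite /= in_itv/= andbT.
    have [[y Xy yx]|nL] := pselect (has_left w); last first.
      rewrite /left_knowledge_point (_ : [set _ | _] = set0); last first.
        by apply/seteqP; split => // y [Xy yx]; apply: nL; exists y.
      by rewrite sup0 => ->; right.
    have ne : [set y | Xi w y /\ y <= x w] !=set0 by exists y.
    move=> /(sup_gt ne)[z [Xz zx] /rat_in_itvoo[p]].
    rewrite in_itv/= => /andP[cp pz]; left; exists p => //; rewrite cp.
    by exists z => //; rewrite zx ltW.
  rewrite /= in_itv/= andbT => -[[p _]|].
    case: ifPn => // cp [y Xy /andP[py yx]].
    by rewrite (lt_le_trans cp)// (le_trans py)// le_left.
  case: ifPn => // c0 nL; rewrite /left_knowledge_point.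
  rewrite (_ : [set _ | _] = set0) ?sup0//.
  by apply/seteqP; split => // y [Xy yx]; apply: nL; exists y.
apply: measurableU; last by case: ifPn => // _; exact: measurableC.
by apply: bigcupT_measurable_rat => p; case: ifPn.
Qed.

Lemma measurable_right : measurable_fun setT (fun w => r w).
Proof.
apply: (@measurability _ _ T (measurableTypeR R) _ _ _
  (RGenInftyO.measurableE R)) => _ [_ [c ->] <-].
rewrite setTI.
have -> : (fun w => r w) @^-1` `]-oo, c[ =
    hit_gt c `|` (if 0 < c then ~` has_right else set0).
  apply/seteqP; split => w.
    rewrite /= in_itv/=.
    have [[y Xy yx]|nL] := pselect (has_right w); last first.
      rewrite /right_knowledge_point (_ : [set _ | _] = set0); last first.
        by apply/seteqP; split => // y [Xy yx]; apply: nL; exists y.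
      by rewrite inf0 => ->; right.
    have ne : [set y | Xi w y /\ x w < y] !=set0 by exists y.
    move=> /(inf_lt ne)[z [Xz zx] zc].
    by left; exists z => //; rewrite zx.
  rewrite /= in_itv/= => -[[y Xy /andP[xy yc]]|].
    by rewrite (le_lt_trans _ yc)// ge_right.
  case: ifPn => // c0 nL; rewrite /right_knowledge_point.
  rewrite (_ : [set _ | _] = set0) ?inf0//.
  by apply/seteqP; split => // y [Xy yx]; apply: nL; exists y.
by apply: measurableU => //; case: ifPn => // _; exact: measurableC.
Qed.

(* Off this almost sure event, [left_knowledge_point] or [right_knowledge_point]
   is a junk value. *)
Definition neighbours : set T := has_left `&` has_right.

Lemma measurable_neighbours : measurable neighbours.
Proof. exact: measurableI. Qed.

Let prob_eq0 (E : set T) : measurable E ->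
  (forall m : R, (P E <= (expR (- (lambda * m)))%:E)%E) -> P E = 0%E.
Proof.
move=> mE PE.
have PEE : P E = (fine (P E))%:E by rewrite fineK// fin_num_measure.
apply/eqP; rewrite eq_le measure_ge0 andbT PEE lee_fin leNgt; apply/negP => v0.
(* If v = P E were positive, this choice of m would give v exp(1 / v) <= 1, whereas exp(1 / v) >= 1
   + 1 / v makes the left side at least v + 1. *)
move: (PE ((lambda * fine (P E))^-1)); rewrite PEE lee_fin.
set v := fine _ in v0 *.
rewrite expRN invfM mulrA divff ?gt_eqF// mul1r => vE.
have := expR_ge1Dx v^-1 => e1.
have : v * expR v^-1 <= 1.
  by rewrite -ler_pdivlMr ?expR_gt0// div1r.
apply/negP; rewrite -ltNge; apply: (@lt_le_trans _ _ (v * (1 + v^-1))).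
  by rewrite mulrDr mulr1 divff ?gt_eqF// ltrDr.
by rewrite ler_pM2l.
Qed.

Lemma prob_neighboursC : P (~` neighbours) = 0%E.
Proof.
(* Mesh 1 is enough: with no point on the left of the task, the interval of length m that ends at
   the left end of its cell is void, for every m. The right side is symmetric. *)
have PL : P (~` has_left) = 0%E.
  apply: prob_eq0 => [|m]; first exact: measurableC.
  apply: (prob_le_void lambda_gt0 HXi Hx Hindep (e := 1)
    (l := fun k => a + k%:R - m) (r := fun k => a + k%:R)) => //.
  - exact: measurableC.
  - by move=> k; rewrite subrK.
  - move=> k w nL /andP[kx _]; apply/seteqP; split => // y [Xy].
    rewrite /= in_itv/= mulr1 in kx * => /andP[_ yk].
    by apply: nL; exists y => //; rewrite (le_trans (ltW yk)).
have PR : P (~` has_right) = 0%E.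
  apply: prob_eq0 => [|m]; first exact: measurableC.
  apply: (prob_le_void lambda_gt0 HXi Hx Hindep (e := 1)
    (l := fun k => a + k.+1%:R) (r := fun k => a + k.+1%:R + m)) => //.
  - exact: measurableC.
  - move=> k w nL /andP[_ xk]; apply/seteqP; split => // y [Xy].
    rewrite /= in_itv/= mulr1 in xk * => /andP[ky _].
    by apply: nL; exists y => //; rewrite (lt_trans xk).
by rewrite /neighbours setCI measureU0//; exact: measurableC.
Qed.

End neighbours.

(** * Joint law of the two gaps and expected posterior variance *)

Lemma ler_addgt0_mull {R : realType} (v e c : R) : 0 <= c ->
  (forall t, 0 < t -> v <= e + c * t) -> v <= e.
Proof.
move=> c0 ve; apply/ler_addgt0Pr => t t0.
(* Dividing by c + 1 instead of c allows c = 0. *)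
apply: le_trans (ve (t / (c + 1)) _) _; first by rewrite divr_gt0// ltr_wpDl.
rewrite lerD2l mulrCA ger_pMr// ler_pdivrMr ?ltr_wpDl// mul1r.
by rewrite lerDl.
Qed.

Section neighbours_law.
Context {R : realType} {d : measure_display} {T : measurableType d}.
Context {P : probability T R} {lambda : R} {a b : R} {ab : a < b}.
Context {Xi : T -> set R} {x : {RV P >-> R}}.
Hypothesis lambda_gt0 : 0 < lambda.
Hypothesis HXi : homogeneous_poisson P lambda Xi.
Hypothesis Hx : uniform_on ab x.
Hypothesis Hindep : independent_of_process Xi x.

Local Notation l w := (left_knowledge_point (Xi w) (x w)).
Local Notation r w := (right_knowledge_point (Xi w) (x w)).
Local Notation N := (neighbours (Xi := Xi) (x := x)).

Let mN : measurable N.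
Proof. exact: measurable_neighbours HXi. Qed.

Let mNC : measurable (~` N).
Proof. exact: measurableC. Qed.

Let PNC : P (~` N) = 0%E.
Proof. exact: (prob_neighboursC lambda_gt0 HXi Hx Hindep). Qed.

(** On [neighbours] the supremum is over a nonempty set bounded above by the task, so a bound on the
    gap becomes a condition on individual points, comparable with void events. *)
Lemma left_gapP w (s : R) : N w ->
  s <= x w - l w <-> (forall y, Xi w y -> y <= x w -> y <= x w - s).
Proof.
move=> [[y0 Xy0 y0x] _]; split => [sl y Xy yx|H].
  rewrite lerBrDr -lerBrDl; apply: le_trans sl _; rewrite lerB//.
  by apply: ub_le_sup => //; exists (x w) => z [].
rewrite lerBrDr -lerBrDl; apply: ge_sup; first by exists y0.
by move=> y [Xy yx]; exact: H.
Qed.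

Lemma right_gapP w (u : R) : N w ->
  u <= r w - x w <-> (forall y, Xi w y -> x w < y -> x w + u <= y).
Proof.
move=> [_ [y0 Xy0 y0x]]; split => [ur y Xy yx|H].
  rewrite -lerBrDl; apply: le_trans ur _; rewrite lerB//.
  by apply: ge_inf => //; exists (x w) => z [_ /ltW].
rewrite lerBrDl; apply: lb_le_inf; first by exists y0.
by move=> y [Xy yx]; exact: H.
Qed.

(** E is described on the almost sure event [neighbours] only, so one statement serves for both
    marginal laws, with u = 0 or s = 0, and for the joint law. *)
Lemma gaps_law (E : set T) (s u : R) : measurable E -> 0 <= s -> 0 <= u ->
  (forall w, N w -> E w <-> s <= x w - l w /\ u <= r w - x w) ->
  P E = (expR (- (lambda * (s + u))))%:E.
Proof.
move=> mE s0 u0 EN.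
have mEN : measurable (E `&` N) by exact: measurableI.
have mENC : measurable (E `|` ~` N) by exact: measurableU.
(* The upper bound is proved for the event cut down to N, the lower bound for the event enlarged by
   the complement of N; both have the probability of E. *)
have PEU : P (E `|` ~` N) = P E by rewrite measureU0.
have PEI : P (E `&` N) = P E.
  rewrite -PEU -(measureU0 mEN mNC PNC); congr (P _); apply/seteqP.
  split => w; first by move=> [[]|]; [left|right].
  by have [Nw|Nw] := pselect (N w); [move=> []; [left|right]|right].
(* This interval, of length s + u - e, lies in ]x - s, x + u[ for every task x in the cell. *)
have upper e : 0 < e -> (P E <= (expR (- (lambda * (s + u - e))))%:E)%E.
  move=> e0; rewrite -PEI; apply: (prob_le_void lambda_gt0 HXi Hx Hindep
    (l := fun k => a + k.+1%:R * e - s)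
    (r := fun k => a + k%:R * e + u) _ e0) => //.
    by move=> k; rewrite -addn1 natrD; lra.
  move=> k w [Ew Nw] /andP[kx xk]; have [sX uY] := (EN w Nw).1 Ew.
  apply/seteqP; split => // y [Xy]; rewrite /= in_itv/= => /andP[ky yk].
  have [yx|xy] := leP y (x w).
    by have := (left_gapP _ Nw).1 sX y Xy yx; lra.
  by have := (right_gapP _ Nw).1 uY y Xy xy; lra.
(* This interval, of length s + u + e, contains ]x - s, x + u[ for every task x in the cell. *)
have lower e : 0 < e -> ((expR (- (lambda * (s + u + e))))%:E <= P E)%E.
  move=> e0; rewrite -PEU; apply: (prob_ge_void lambda_gt0 HXi Hx Hindep
    (l := fun k => a + k%:R * e - s)
    (r := fun k => a + k.+1%:R * e + u) _ e0) => //.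
    by move=> k; rewrite -addn1 natrD; apply/andP; split; lra.
  move=> k w vw /andP[kx xk]; have [Nw|Nw] := pselect (N w); last by right.
  left; apply/(EN w Nw); split.
    apply/left_gapP => // y Xy yx; rewrite leNgt; apply/negP => ys.
    suff : (Xi w `&` `]a + k%:R * e - s, a + k.+1%:R * e + u[) y by rewrite vw.
    by split => //; rewrite /= in_itv/=; apply/andP; split; lra.
  apply/right_gapP => // y Xy yx; rewrite leNgt; apply/negP => ys.
  suff : (Xi w `&` `]a + k%:R * e - s, a + k.+1%:R * e + u[) y by rewrite vw.
  by split => //; rewrite /= in_itv/=; apply/andP; split; lra.
have PEE : P E = (fine (P E))%:E by rewrite fineK// fin_num_measure.
have v1 : fine (P E) <= 1 by rewrite -lee_fin -PEE probability_le1.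
have v0 : 0 <= fine (P E) by rewrite fine_ge0.
move: upper lower; rewrite PEE; set v := fine (P E) in v0 v1 * => upper lower.
set g := expR _.
have g0 : 0 < g by exact: expR_gt0.
have g1 : g <= 1 by rewrite -expR0 ler_expR oppr_le0 mulr_ge0 ?addr_ge0// ltW.
(* Since exp y >= 1 + y and both v and g are at most 1, each bound has an error of at most lambda
   e. *)
congr EFin; apply/le_anti/andP; split; apply: (@ler_addgt0_mull _ _ _ lambda).
- exact: ltW.
- move=> e e0; have := upper e e0; rewrite lee_fin.
  rewrite (_ : - _ = - (lambda * (s + u)) + lambda * e); last by ring.
  rewrite expRD -/g => vg.
  have := expR_ge1Dx (- (lambda * e)); rewrite expRN => e1.
  have : v * (1 - lambda * e) <= g.
    rewrite (le_trans (ler_wpM2l v0 e1))// ler_pdivrMr ?expR_gt0//.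
  have le0 : 0 < lambda * e by rewrite mulr_gt0.
  by nra.
- exact: ltW.
- move=> e e0; have := lower e e0; rewrite lee_fin.
  rewrite (_ : - _ = - (lambda * (s + u)) + - (lambda * e)); last by ring.
  rewrite expRD -/g => gv.
  have := expR_ge1Dx (- (lambda * e)) => e1.
  have := le_trans (ler_wpM2l (ltW g0) e1) gv.
  have le0 : 0 < lambda * e by rewrite mulr_gt0.
  by nra.
Qed.

Let mx : measurable_fun setT (x : T -> R).
Proof. exact: measurable_funPT. Qed.

Let ml := measurable_left HXi (x := x).
Let mr := measurable_right HXi (x := x).

Let mX : measurable_fun setT ((fun w => x w - l w) : T -> measurableTypeR R).
Proof. exact: measurable_funB. Qed.

Let mY : measurable_fun setT ((fun w => r w - x w) : T -> measurableTypeR R).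
Proof. exact: measurable_funB. Qed.

Lemma measurable_posterior_variance :
  measurable_fun setT (fun w => posterior_variance (Xi w) (x w)).
Proof.
apply: measurable_funM; first exact: measurable_funM.
by apply: (measurableT_comp measurable_invr); exact: measurable_funB.
Qed.

Lemma expectation_posterior_variance :
  P.-integrable setT (fun w => (posterior_variance (Xi w) (x w))%:E) /\
  (\int[P]_w (posterior_variance (Xi w) (x w))%:E = ((3 * lambda)^-1)%:E)%E.
Proof.
pose X : {RV P >-> measurableTypeR R} :=
  HB.pack (fun w => x w - l w) (isMeasurableFun.Build _ _ _ _ _ mX).
pose Y : {RV P >-> measurableTypeR R} :=
  HB.pack (fun w => r w - x w) (isMeasurableFun.Build _ _ _ _ _ mY).
have X0 w : N w -> 0 <= X w.
  by move=> Nw; apply/left_gapP => // y; rewrite subr0.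
have Y0 w : N w -> 0 <= Y w.
  by move=> Nw; apply/right_gapP => // y _; rewrite addr0 => /ltW.
have mray (Z : {RV P >-> measurableTypeR R}) (s : R) :
    measurable (Z @^-1` `[s, +oo[).
  by apply: measurable_preimage; exact: measurable_itv.
have max0 (s : R) : 0 <= Num.max s 0 by rewrite le_max lexx orbT.
have rayE (Z : {RV P >-> measurableTypeR R}) w (s : R) : 0 <= Z w ->
    (Z @^-1` `[s, +oo[) w <-> Num.max s 0 <= Z w.
  by move=> Z0; rewrite /= in_itv/= andbT ge_max Z0 andbT.
have X_exp s : P (X @^-1` `[s, +oo[) = (expR (- (lambda * Num.max s 0)))%:E.
  rewrite (@gaps_law _ (Num.max s 0) 0) ?addr0// => w Nw.
  by rewrite rayE ?X0//; split => [|[]]//; split => //; exact: Y0.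
have Y_exp s : P (Y @^-1` `[s, +oo[) = (expR (- (lambda * Num.max s 0)))%:E.
  rewrite (@gaps_law _ 0 (Num.max s 0)) ?add0r// => w Nw.
  by rewrite rayE ?Y0//; split => [|[]]//; split => //; exact: X0.
(* The joint tail depends on the sum of the two thresholds only, and the exponential of a sum
   factors. *)
have XY s u : P (X @^-1` `[s, +oo[ `&` Y @^-1` `[u, +oo[) =
    (P (X @^-1` `[s, +oo[) * P (Y @^-1` `[u, +oo[))%E.
  rewrite X_exp Y_exp -EFinM -expRD -opprD -mulrDr.
  apply: gaps_law => //; first exact: measurableI.
  move=> w Nw; have rX := rayE X w s (X0 w Nw); have rY := rayE Y w u (Y0 w Nw).
  by split=> -[sX uY]; split; [exact: rX.1|exact: rY.1|exact: rX.2|exact: rY.2].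
pose H w := (Num.max (X w) 0 * Num.max (Y w) 0) /
            (Num.max (X w) 0 + Num.max (Y w) 0).
have HE : (\int[P]_w (H w)%:E = ((3 * lambda)^-1)%:E)%E.
  exact: expectation_harmonic lambda_gt0 X_exp Y_exp XY.
have mH : measurable_fun setT H.
  have mX0 : measurable_fun setT (fun w => Num.max (X w) 0).
    exact: measurable_maxr.
  have mY0 : measurable_fun setT (fun w => Num.max (Y w) 0).
    exact: measurable_maxr.
  apply: measurable_funM; first exact: measurable_funM.
  by apply: (measurableT_comp measurable_invr); exact: measurable_funD.
have H0 w : 0 <= H w by rewrite divr_ge0 ?mulr_ge0 ?addr_ge0.
(* On [neighbours] both gaps are nonnegative and sum to r - l, so the bridge variance is X Y / (X +
   Y). *)
have VH : ae_eq P setT (fun w => (posterior_variance (Xi w) (x w))%:E)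
    (EFin \o H).
  exists (~` N); split => // w; apply: contra_not => /= Nw _.
  congr EFin; rewrite /H !max_l ?X0 ?Y0//.
  by rewrite /posterior_variance/=; congr (_ / _); lra.
have iH : P.-integrable setT (EFin \o H).
  apply/integrableP; split; first exact/measurable_EFinP.
  under eq_integral do rewrite /= ger0_norm//.
  by rewrite HE ltry.
have mV : measurable_fun setT (fun w => (posterior_variance (Xi w) (x w))%:E).
  by apply/measurable_EFinP; exact: measurable_posterior_variance.
split; last by rewrite (ae_eq_integral (EFin \o H))//; exact/measurable_EFinP.
have mHE : measurable_fun setT (EFin \o H) by exact/measurable_EFinP.
have [_ Hoo] := integrableP _ _ _ iH.
apply/integrableP; split => //.
rewrite (ae_eq_integral (abse \o (EFin \o H)))//; first exact: measurableT_comp.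
  exact: measurableT_comp.
exact: ae_eq_abse.
Qed.

End neighbours_law.

(** * Expected payoff and the adoption threshold *)

Theorem theorem1 (R : realType) (d : measure_display) (T : measurableType d)
    (P : probability T R) (lambda q : R) (a b : R) (ab : a < b)
    (Xi : T -> set R) (x : {RV P >-> R})
    (lambda_gt0 : 0 < lambda) (q_gt0 : 0 < q)
    (HXi : homogeneous_poisson P lambda Xi)
    (Hx : uniform_on ab x)
    (Hindep : independent_of_process Xi x) :
  let U := fun w => payoff q (Xi w) (x w) in
  (blind_adopts P U <-> 1 / (3 * lambda) <= q) /\
  (blind_adopts P U <-> 1 <= reliability_ratio lambda q).
Proof.
move=> U.
have [iV EV] := expectation_posterior_variance lambda_gt0 HXi Hx Hindep.
(* Integrability of the posterior variance justifies linearity of the expectation. *)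
have EU : 'E_P[U]%E = (1 - (3 * lambda)^-1 / q)%:E.
  rewrite unlock /U /payoff.
  under eq_integral do rewrite EFinB mulrC EFinM.
  rewrite integralB//=; last 2 first.
  - exact: finite_measure_integrable_cst.
  - exact: integrableZl.
  rewrite integralZl// EV [X in (X - _)%E](_ : _ = 1%E); last first.
    by rewrite integral_cst// mul1e; exact: probability_setT.
  by rewrite -EFinM -EFinB (mulrC q^-1).
have l3 : 0 < 3 * lambda by rewrite mulr_gt0.
rewrite /blind_adopts EU lee_fin subr_ge0 ler_pdivrMr// !mul1r.
rewrite /reliability_ratio.
split; first by [].
by rewrite -(mulr1 (3 * lambda)^-1) ler_pdivrMl//.
Qed.
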